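(* Let $H$ be a non-trivial finitely generated subgroup of $F_m$. Then $\widehat{\mathcal{D}}_H$ is an ergodic automaton if and only if $H$ is conjugacy reduced and non cyclic.
   Context: Automata. The Moore diagram of a finite automaton with states $Q$ and transition function $\delta$ is the directed graph on $Q$ with an edge labelled $x$ from $q$ to $q'$ whenever $\delta$ allows moving from $q$ to $q'$ on reading $x$. An automaton is ergodic if its Moore diagram is strongly connected, i.e. for any two states $q,q'$ there is a directed path from $q$ to $q'$. Free group and core. $A=\{a_1,\dots,a_m\}$ is a fixed basis of $F_m$ and $\Sigma=A\cup A^{-1}$. A word over $\Sigma$ is reduced if it has no subword $xx^{-1}$, $x\in\Sigma$. $L_H\subseteq\Sigma^*$ is the set of reduced words (including the empty word) representing elements of $H$. The extended Schreier graph $\widehat\Gamma$ of $H$ has as vertices the right cosets $Hg$, $g\in F_m$, with exactly one edge labelled $x$ from $Hg$ to $Hgx$ for every vertex $Hg$ and every $x\in\Sigma$. The root is $v_0=H$. The extended core $\widehat\Delta_H=(\widehat V,\widehat E,\widehat\mu)$ is the subgraph of $\widehat\Gamma$ consisting of $v_0$ and all vertices and edges lying on closed paths based at $v_0$ with reduced label; it is finite when $H$ is finitely generated. $\widehat\mu(e),t(e)$ are the label and terminus of an edge $e$. If $\widehat E$ contains an edge with origin $v$ and label $x$, its terminus is denoted $vx$. The automaton $\widehat{\mathcal{D}}_H$. It has alphabet $\Sigma$, states $\{(v,x)\mid v\in\widehat V,\ x\in\Sigma,\ \exists e\in\widehat E\text{ with }\widehat\mu(e)=x,\ t(e)=v\}$,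 the set of initial states and the set of final states both equal to the set of states of the form $(v_0,x)$, and transitions $\delta((v,x),y)=(vy,y)$ whenever $y\neq x^{-1}$ and $\widehat E$ has an edge labelled $y$ with origin $v$ (undefined otherwise). $H$ is conjugacy reduced if there is no $a\in\Sigma$ such that every non-empty word of $L_H$ is of the form $a^{-1}wa$; equivalently, there are two non-empty words in $L_H$ with different last letters. *)

(* Defs.v *)
From HB Require Import structures.
From mathcomp Require Import all_boot.
From mathcomp Require Import boolp classical_sets.

Set Implicit Arguments.
Unset Strict Implicit.
Unset Printing Implicit Defensive.

Import Algebra.

Local Open Scope classical_set_scope.
Local Open Scope group_scope.

(* [(i, true)] is the basis element a_i, [(i, false)] is its formal inverse. *)
Notation letter m := ('I_m * bool)%type.

Definition linv m (x : letter m) : letter m := (x.1, ~~ x.2).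
Arguments linv {m} x : simpl never.

Definition reduced m (w : seq (letter m)) : bool :=
  sorted (fun x y => y != linv x) w.

Lemma linvK m : involutive (@linv m).
Proof. by case=> i b; rewrite /linv /= negbK. Qed.

Section FreeReduction.
Variable m : nat.
Implicit Types (x y : letter m) (u v w : seq (letter m)).

(* The reduced form of [x :: w], for [w] reduced. *)
Definition push x w : seq (letter m) :=
  if w is y :: w' then if y == linv x then w' else x :: w else [:: x].

Lemma push_reduced x w : reduced w -> reduced (push x w).
Proof.
case: w => [|y w] //= red_yw; case: ifPn => [_|/= ->]; last by [].
exact: path_sorted red_yw.
Qed.

Lemma foldr_push_reduced u v : reduced v -> reduced (foldr push v u).
Proof. by move=> red_v; elim: u => //= x u; apply: push_reduced. Qed.

Lemma push_id x w : reduced (x :: w) -> push x w = x :: w.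
Proof. by case: w => [|y w] //= /andP[/negPf->]. Qed.

Lemma pushK x w : reduced w -> push x (push (linv x) w) = w.
Proof.
case: w => [|y w] /=; first by rewrite eqxx.
rewrite linvK; case: eqVneq => [->|_] red_w /=; last by rewrite eqxx.
exact: push_id.
Qed.

Lemma foldr_push_push w x u :
  reduced w -> foldr push w (push x u) = push x (foldr push w u).
Proof.
case: u => [|y u] //= red_w; case: eqVneq => [->|_] //=.
by rewrite pushK // foldr_push_reduced.
Qed.

Lemma foldr_pushA u v w :
  reduced w -> foldr push (foldr push w v) u = foldr push w (foldr push v u).
Proof.
by move=> red_w; elim: u => //= x u ->; rewrite foldr_push_push.
Qed.

Lemma foldr_push0 u : reduced u -> foldr push [::] u = u.
Proof.
elim: u => //= x u IHu red_xu.
by rewrite IHu ?push_id //; apply: path_sorted red_xu.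
Qed.

Definition winv u : seq (letter m) := rev (map (@linv m) u).

Lemma winv_reduced u : reduced u -> reduced (winv u).
Proof.
rewrite /reduced /winv rev_sorted sorted_map; apply: sub_sorted => x y /=.
by rewrite (inj_eq (inv_inj (@linvK m))) eq_sym; apply: contraNneq => ->;
  rewrite linvK.
Qed.

Lemma foldr_push_winv u : foldr push u (winv u) = [::].
Proof.
rewrite /winv; elim: u => //= x u IHu.
by rewrite rev_cons foldr_rcons /= linvK eqxx.
Qed.

Lemma winvK : involutive winv.
Proof. by move=> u; rewrite /winv map_rev revK mapK //; apply: linvK. Qed.

End FreeReduction.

Record free_group (m : nat) : Type := FreeGroup {
  fg_word :> seq (letter m);
  fg_wordP : reduced fg_word
}.

HB.instance Definition _ m := [isSub for @fg_word m].
HB.instance Definition _ m := [Choice of free_group m by <:].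

Section FreeGroup.
Variable m : nat.
Implicit Types f g h : free_group m.

Definition fg_one : free_group m := @FreeGroup m [::] isT.

Definition fg_mul g h : free_group m :=
  FreeGroup (foldr_push_reduced g (fg_wordP h)).

Definition fg_inv g : free_group m := FreeGroup (winv_reduced (fg_wordP g)).

Lemma fg_mulA : associative fg_mul.
Proof.
by move=> f g h; apply: val_inj; rewrite /= foldr_pushA ?fg_wordP.
Qed.

Lemma fg_mul1g : left_id fg_one fg_mul.
Proof. by move=> g; apply: val_inj. Qed.

Lemma fg_mulg1 : right_id fg_one fg_mul.
Proof. by move=> g; apply: val_inj; rewrite /= foldr_push0 ?fg_wordP. Qed.

Lemma fg_mulVg : left_inverse fg_one fg_inv fg_mul.
Proof. by move=> g; apply: val_inj; rewrite /= foldr_push_winv. Qed.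

Lemma fg_mulgV : right_inverse fg_one fg_inv fg_mul.
Proof.
by move=> g; apply: val_inj; rewrite /= -{2}[fg_word g]winvK foldr_push_winv.
Qed.

End FreeGroup.

HB.instance Definition _ m := isGroup.Build (free_group m)
  (@fg_mulA m) (@fg_mul1g m) (@fg_mulg1 m) (@fg_mulVg m) (@fg_mulgV m).

Definition fg_letter m (x : letter m) : free_group m :=
  @FreeGroup m [:: x] isT.

Definition word_val m (w : seq (letter m)) : free_group m :=
  \prod_(x <- w) fg_letter x.

Lemma fg_wordK m (g : free_group m) : word_val g = g.
Proof.
case: g => w red_w; apply: val_inj; rewrite /= -[RHS]foldr_push0 //.
by elim: w {red_w} => [|x w IHw]; rewrite /word_val ?big_nil ?big_cons //= IHw.
Qed.

Lemma free_group_universal m (G : groupType) (f : 'I_m -> G) :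
  exists! phi : free_group m -> G,
    {morph phi : g h / g * h} /\ forall i, phi (fg_letter (i, true)) = f i.
Proof.
pose fl (x : letter m) := if x.2 then f x.1 else (f x.1)^-1.
have fl_push x w : \prod_(y <- push x w) fl y = fl x * \prod_(y <- w) fl y.
  case: w => [|y w] /=; first by rewrite big_cons.
  case: eqVneq => [->|_]; last by rewrite big_cons.
  rewrite big_cons mulgA; case: x => i [] /=;
    by rewrite /fl /linv /= ?mulgV ?mulVg mul1g.
exists (fun g => \prod_(x <- fg_word g) fl x); split; first split.
- move=> g h /=; case: g => u _ /=.
  by elim: u => [|x u IHu] /=; rewrite ?big_nil ?mul1g // fl_push IHu big_cons mulgA.
- by move=> i; rewrite /= big_cons big_nil mulg1.
move=> phi [phiM phiE]; apply/funext => g.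
have phi1 : phi 1 = 1 by apply: (mulgI (phi 1)); rewrite -phiM !mulg1.
rewrite -[in RHS](fg_wordK g) /word_val; elim: (fg_word g) => [|x u IHu].
  by rewrite !big_nil phi1.
rewrite !big_cons phiM -IHu; congr (_ * _); rewrite /fl.
case: x => i [] /=; first by rewrite phiE.
apply: (mulgI (f i)); rewrite mulgV -phiE -phiM -phi1; congr phi.
by apply: val_inj; rewrite /= /linv /= eqxx.
Qed.

Section Subgroups.
Variable G : groupType.
Implicit Types (H S : set G).

Definition subgroup H : Prop := group_closed [in H].

Definition generated S : set G := smallest subgroup S.

Definition finitely_generated H : Prop :=
  exists s : seq G, H = generated [set` s].

Definition cyclic H : Prop := exists g : G, H = generated [set g].

Definition nontrivial H : Prop := H <> [set 1].

Definition right_coset H (g : G) : set G := [set h * g | h in H].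

End Subgroups.

(* An edge is a triple (origin, label, terminus). *)
Notation ledge V L := (V * L * V)%type.

Section Edge.
Variables V L : Type.
Implicit Type e : ledge V L.

Definition origin e : V := e.1.1.
Definition label e : L := e.1.2.
Definition terminus e : V := e.2.

End Edge.

Record lgraph (V L : Type) : Type := LGraph {
  vertices : set V;
  edges : set (ledge V L);
  edges_vertices :
    forall e, edges e -> vertices (origin e) /\ vertices (terminus e)
}.

Section Paths.
Variables V L : Type.
Implicit Types (D : lgraph V L) (v : V) (p : seq (ledge V L)).

Fixpoint dipath D v p v' : Prop :=
  if p is e :: p' then
    [/\ edges D e, origin e = v & dipath D (terminus e) p' v']
  else vertices D v /\ v = v'.

Definition strongly_connected D : Prop :=
  forall v v', vertices D v -> vertices D v' -> exists p, dipath D v p v'.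

End Paths.

(* [delta q x] is the set of states reachable from [q] on reading [x]; it is
   empty when the transition is undefined. *)
Record automaton (Q L : Type) : Type := Automaton {
  states : set Q;
  initial : set Q;
  final : set Q;
  delta : Q -> L -> set Q
}.

Section Ergodic.
Variables Q L : Type.
Implicit Type M : automaton Q L.

Definition moore_edges M : set (ledge Q L) :=
  [set e | [/\ states M (origin e), states M (terminus e)
             & delta M (origin e) (label e) (terminus e)]].

Lemma moore_edges_vertices M e :
  moore_edges M e -> states M (origin e) /\ states M (terminus e).
Proof. by case. Qed.

Definition moore_diagram M : lgraph Q L :=
  LGraph (@moore_edges_vertices M).

Definition ergodic M : Prop := strongly_connected (moore_diagram M).

End Ergodic.

Section Core.
Variables (m : nat) (H : set (free_group m)).

Definition reduced_words : set (seq (letter m)) :=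
  [set w | reduced w /\ H (word_val w)].

Definition conjugacy_reduced : Prop :=
  ~ exists a : letter m, forall w, reduced_words w -> w <> [::] ->
      exists u, w = linv a :: rcons u a.

(* Right cosets are vertices as subsets of the free group. *)
Definition schreier_vertices : set (set (free_group m)) :=
  [set right_coset H g | g in setT].

Definition schreier_edges : set (ledge (set (free_group m)) (letter m)) :=
  [set e | exists g x,
     e = (right_coset H g, x, right_coset H (g * fg_letter x))].

Lemma schreier_edges_vertices e : schreier_edges e ->
  schreier_vertices (origin e) /\ schreier_vertices (terminus e).
Proof.
by move=> [g [x ->]]; split; [exists g | exists (g * fg_letter x)].
Qed.

Definition schreier_graph : lgraph (set (free_group m)) (letter m) :=
  LGraph schreier_edges_vertices.

Definition root : set (free_group m) := H.

Definition reduced_closed_path (p : seq (ledge _ (letter m))) : Prop :=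
  dipath schreier_graph root p root /\ reduced [seq label e | e <- p].

Definition core_edges : set (ledge (set (free_group m)) (letter m)) :=
  [set e | exists2 p, reduced_closed_path p & e \in p].

Definition core_vertices : set (set (free_group m)) :=
  [set v | v = root \/
    exists2 e, core_edges e & v = origin e \/ v = terminus e].

Lemma core_edges_vertices e :
  core_edges e -> core_vertices (origin e) /\ core_vertices (terminus e).
Proof. by move=> core_e; split; right; exists e; auto. Qed.

Definition extended_core : lgraph (set (free_group m)) (letter m) :=
  LGraph core_edges_vertices.

Definition core_states : set (set (free_group m) * letter m) :=
  [set q | vertices extended_core q.1 /\
     exists e, [/\ edges extended_core e, label e = q.2 & terminus e = q.1]].

Definition core_root_states : set (set (free_group m) * letter m) :=
  [set q | core_states q /\ q.1 = root].

Definition core_delta (q : set (free_group m) * letter m) (y : letter m) :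
    set (set (free_group m) * letter m) :=
  [set q' | y <> linv q.2 /\
     exists e, [/\ edges extended_core e, origin e = q.1, label e = y
                 & q' = (terminus e, y)]].

Definition core_automaton :
    automaton (set (free_group m) * letter m) (letter m) :=
  Automaton core_states core_root_states core_root_states core_delta.

End Core.

(* A coset has exactly one outgoing Schreier edge with a given label, hence
   [core_delta] is a partial function. *)
Lemma schreier_edge_functional m (H : set (free_group m)) e e' :
  schreier_edges H e -> schreier_edges H e' ->
  origin e = origin e' -> label e = label e' -> e = e'.
Proof.
move=> [g [x ->]] [g' [x' ->]]; rewrite /origin /label /= => Hgg' <-.
have mulD k y : right_coset H (k * y) = [set z * y | z in right_coset H k].
  by rewrite /right_coset image_comp; under [RHS]eq_imagel do rewrite /= -mulgA.
by rewrite !mulD Hgg'.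
Qed.

Lemma root_schreier_vertex m (H : set (free_group m)) :
  schreier_vertices H (root H).
Proof.
by exists 1 => //; rewrite /right_coset /root; under eq_imagel do rewrite mulg1;
   rewrite image_id.
Qed.

Lemma core_delta_functional m (H : set (free_group m)) q y q1 q2 :
  core_delta H q y q1 -> core_delta H q y q2 -> q1 = q2.
Proof.
have core_sub p v v' e : dipath (schreier_graph H) v p v' -> e \in p ->
    schreier_edges H e.
  elim: p v => [|e' p IHp] //= v [He' _ /IHp IH]; rewrite inE.
  by case/orP => [/eqP->|/IH].
move=> [_ [e1 [[p1 [path1 _] p1e1] o1 l1 ->]]].
move=> [_ [e2 [[p2 [path2 _] p2e2] o2 l2 ->]]].
congr (terminus _, _); apply: schreier_edge_functional.
- exact: core_sub path1 p1e1.
- exact: core_sub path2 p2e2.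
- by rewrite o1.
- by rewrite l1.
Qed.

(* Main.v *)
Require Import Defs.
From mathcomp Require Import all_boot.
From mathcomp Require Import boolp classical_sets.

(* The states of the automaton are the oriented edges of the core, and its
   transitions are the non-backtracking steps.  Every core edge lies on a reduced
   closed path through the root, so ergodicity amounts to being able to turn
   around at the root: for each letter x, some word of L_H must neither start with
   x^-1 nor end with x.  If no such word exists for x, then H is generated by a
   shortest word of L_H not ending with x, which exists when H is conjugacy
   reduced. *)

Set Implicit Arguments.
Unset Strict Implicit.
Unset Printing Implicit Defensive.

Import Algebra.

Local Open Scope classical_set_scope.
Local Open Scope group_scope.

(** * Words, formal inverses and cancellation *)

Section Words.
Variable m : nat.
Implicit Types (x y : letter m) (u v w p q c : seq (letter m)).

Lemma linv_neq x : linv x != x.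
Proof. by case: x => i []; rewrite /linv xpair_eqE eqxx. Qed.

Lemma word_val_cat u v : word_val (u ++ v) = word_val u * word_val v.
Proof. exact: big_cat. Qed.

Lemma word_val_cons x u : word_val (x :: u) = fg_letter x * word_val u.
Proof. exact: big_cons. Qed.

Lemma word_val_nil : word_val [::] = 1 :> free_group m.
Proof. exact: big_nil. Qed.

Lemma word_val1 x : word_val [:: x] = fg_letter x.
Proof. by rewrite word_val_cons word_val_nil mulg1. Qed.

Lemma fg_letter_linv x : fg_letter (linv x) = (fg_letter x)^-1.
Proof. exact: val_inj. Qed.

Lemma word_val_winv u : word_val (winv u) = (word_val u)^-1.
Proof.
elim: u => [|x u IHu]; first by rewrite word_val_nil invg1.
rewrite /winv map_cons rev_cons -cats1 word_val_cat IHu word_val1.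
by rewrite fg_letter_linv word_val_cons invgM.
Qed.

Lemma reduced_word_valK w : reduced w -> fg_word (word_val w) = w.
Proof.
by move=> red_w; rewrite -[w in word_val w]/(fg_word (FreeGroup red_w)) fg_wordK.
Qed.

Lemma size_word_val w : size (fg_word (word_val w)) <= size w.
Proof.
elim: w => [|x w IHw]; first by rewrite word_val_nil.
rewrite word_val_cons /= /push; case: (fg_word _) IHw => //= y u ltuw.
by case: ifP => //= _; rewrite ltnW // ltnW.
Qed.

Lemma size_winv u : size (winv u) = size u.
Proof. by rewrite /winv size_rev size_map. Qed.

(** The defaults [x] and [linv x] are matched so that the identity also covers the empty word. *)
Lemma last_winv x u : last x (winv u) = linv (head (linv x) u).
Proof. by case: u => [|y u]; rewrite /= ?linvK // /winv /= rev_cons last_rcons. Qed.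

Lemma head_winv x u : head (linv x) (winv u) = linv (last x u).
Proof.
case/lastP: u => [|u y] //.
by rewrite last_rcons /winv map_rcons rev_rcons.
Qed.

Lemma reduced_catl u v : reduced (u ++ v) -> reduced u.
Proof. by case/cat_sorted2. Qed.

Lemma reduced_catr u v : reduced (u ++ v) -> reduced v.
Proof. by case/cat_sorted2. Qed.

(** Induction on [u]: a new front letter [x] meets [q] only when [p] is empty. It then joins the
    cancelled part [c] if [q] starts with [linv x], and becomes [p] otherwise. *)
Lemma reduced_product u v : reduced u -> reduced v ->
  exists p c q, [/\ u = p ++ c, v = winv c ++ q & reduced (p ++ q)].
Proof.
elim: u => [|x u IHu] red_u red_v; first by exists [::], [::], v.
have [p [c [q [Du Dv red_pq]]]] := IHu (path_sorted red_u) red_v.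
case: p => [|y p] in Du red_pq *; last first.
  exists (x :: y :: p), c, q; split; rewrite ?Du //=.
  by move: red_u; rewrite Du /= => /andP[->].
case: q => [|y q] in Dv red_pq *; first by exists [:: x], c, [::]; rewrite Du.
have [Dy|neq_yx] := eqVneq y (linv x); last first.
  by exists [:: x], c, (y :: q); split; rewrite ?Du //= neq_yx.
exists [::], (x :: c), q; split; first by rewrite Du.
- by rewrite Dv Dy /winv map_cons rev_cons cat_rcons.
- exact: path_sorted red_pq.
Qed.

End Words.

(** * Subgroups, right cosets and commutation in cyclic groups *)

Section SubgroupTheory.
Variables (G : groupType) (H : set G).
Hypothesis sgH : subgroup H.
Implicit Types g h : G.

Lemma subgroup1 : H 1.
Proof. by case: sgH => /set_mem. Qed.

Lemma subgroupV g : H g -> H g^-1.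
Proof. by move=> /mem_set Hg; apply/set_mem/(group_closedV sgH). Qed.

Lemma subgroupM g h : H g -> H h -> H (g * h).
Proof. by move=> /mem_set Hg /mem_set Hh; apply/set_mem/(group_closedM sgH). Qed.

Lemma subgroupMl g h : H g -> H (g * h) -> H h.
Proof.
by move=> Hg Hgh; rewrite -(mulKg g h); apply: subgroupM Hgh; apply: subgroupV.
Qed.

Lemma subgroupMr g h : H h -> H (g * h) -> H g.
Proof.
by move=> Hh Hgh; rewrite -(mulgK h g); apply: (subgroupM Hgh); apply: subgroupV.
Qed.

Lemma right_coset_eq1 g : right_coset H g = H <-> H g.
Proof.
split=> [<-|Hg]; first by exists 1; rewrite ?mul1g //; apply: subgroup1.
apply/seteqP; split=> [_ [h Hh <-]|h Hh]; first exact: subgroupM.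
by exists (h * g^-1); [apply/subgroupM/subgroupV | rewrite mulgVK].
Qed.

End SubgroupTheory.

Lemma right_cosetM (G : groupType) (H : set G) (g h k : G) :
  right_coset H g = right_coset H h -> right_coset H (g * k) = right_coset H (h * k).
Proof.
have mulD f : right_coset H (f * k) = [set z * k | z in right_coset H f].
  by rewrite /right_coset image_comp; under [RHS]eq_imagel do rewrite /= -mulgA.
by rewrite !mulD => ->.
Qed.

Lemma right_coset1 (G : groupType) (H : set G) : right_coset H 1 = H.
Proof. by rewrite /right_coset; under eq_imagel do rewrite mulg1; rewrite image_id. Qed.

Lemma centralizer_subgroup (G : groupType) (S : set G) :
  subgroup [set h | forall g, S g -> commute h g].
Proof.
split; first by apply/mem_set => g _; apply/commute_sym/commute1.
move=> h k /set_mem Ch /set_mem Ck; apply/mem_set => g Sg.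
apply/commute_sym/commuteM; first exact/commute_sym/Ch.
exact/commuteV/commute_sym/Ck.
Qed.

(** Minimality of the generated subgroup is used twice: the centralizer of the generator [b]
    contains [h], so the centralizer of [h] contains [b], hence [g]. *)
Lemma cyclic_commute (G : groupType) (H : set G) (g h : G) :
  cyclic H -> H g -> H h -> commute g h.
Proof.
case=> b -> Hg Hh.
have comm_b k : generated [set b] k -> commute k b.
  move=> Hk; apply: (smallest_sub (@centralizer_subgroup _ [set b]) _ Hk) => //.
  by move=> _ -> _ ->.
apply: (smallest_sub (@centralizer_subgroup _ [set h]) _ Hg) => // _ -> _ ->.
exact/commute_sym/comm_b.
Qed.

(** * Products in [L_H] and the word that turns around at the root *)

Section TurningWord.
Variables (m : nat) (H : set (free_group m)).
Hypothesis sgH : subgroup H.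
Implicit Types (x y : letter m) (u v w p q c : seq (letter m)).

Lemma reduced_words_winv w : reduced_words H w -> reduced_words H (winv w).
Proof.
case=> red_w Hw; split; first exact: winv_reduced.
by rewrite word_val_winv; apply: subgroupV.
Qed.

Lemma reduced_words_product u v : reduced_words H u -> reduced_words H v ->
  exists p c q, [/\ u = p ++ c, v = winv c ++ q & reduced_words H (p ++ q)].
Proof.
move=> [red_u Hu] [red_v Hv].
have [p [c [q [Du Dv red_pq]]]] := reduced_product red_u red_v.
exists p, c, q; split=> //; split=> //.
have := subgroupM sgH Hu Hv.
by rewrite Du Dv !word_val_cat word_val_winv -mulgA mulVKg.
Qed.

(* With default [x], [last x w != x] also says that [w] is not empty. *)
Lemma conjugacy_reduced_last x :
  conjugacy_reduced H -> exists2 w, reduced_words H w & last x w != x.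
Proof.
move=> crH; apply: contrapT => noW; apply: crH; exists x => w Hw w_n0.
have lastE v : reduced_words H v -> last x v = x.
  by move=> Hv; apply: contrapT => /eqP ltv; apply: noW; exists v.
(* The inverse of [w] also ends with [x], which gives the first letter of [w]. *)
have headE : head (linv x) w = linv x.
  by rewrite -[LHS]linvK -last_winv (lastE _ (reduced_words_winv Hw)).
move: (lastE _ Hw); case: w => // y w in w_n0 headE Hw *; move: headE => /= ->.
case/lastP: w {w_n0 Hw} => [/eqP|w z]; first by rewrite (negPf (linv_neq x)).
by rewrite last_rcons => ->; exists w.
Qed.

Lemma generated_subgroup (S : set (free_group m)) : subgroup (generated S).
Proof.
split; first by apply/mem_set => K [sgK _]; apply: subgroup1.
move=> g h /set_mem Sg /set_mem Sh; apply/mem_set => K sK.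
have [sgK _] := sK.
exact: subgroupM (Sg K sK) (subgroupV sgK (Sh K sK)).
Qed.

(* Otherwise let [b] be shortest among the words of [L_H] not ending with [x].  A
   word [w] not ending with [x] has [b] as a prefix, since [b^-1] does not start
   with [x^-1]; an arbitrary [w] becomes shorter or stops ending with [x] when
   multiplied by [b] on the right. *)
Lemma turning_word x : conjugacy_reduced H -> ~ cyclic H ->
  exists w, [/\ reduced_words H w, head (linv x) w != linv x & last x w != x].
Proof.
move=> crH ncH; apply: contrapT => noW.
have headE w : reduced_words H w -> last x w != x -> head (linv x) w = linv x.
  by move=> Hw ltw; apply: contrapT => /eqP hdw; apply: noW; exists w.
have [b [Hb ltb minb]] : exists b, [/\ reduced_words H b, last x b != x &
    forall w, reduced_words H w -> last x w != x -> size b <= size w].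
  pose P n := `[< exists w, [/\ reduced_words H w, last x w != x & size w = n] >].
  have exP : exists n, P n.
    have [w Hw ltw] := conjugacy_reduced_last x crH.
    by exists (size w); apply/asboolP; exists w.
  case: (ex_minnP exP) => n /asboolP[b [Hb ltb <-]] minb.
  by exists b; split=> // w Hw ltw; apply: minb; apply/asboolP; exists w.
set K := generated [set word_val b].
have sgK : subgroup K by apply: generated_subgroup.
have Kb : K (word_val b) by apply: sub_gen_smallest.
have b_gt0 : 0 < size b by case: (b) ltb; rewrite //= eqxx.
have KB w : reduced_words H w -> last x w != x -> K (word_val w).
  move: {2}(size w).+1 (ltnSn (size w)) => n; elim: n w => // n IHn w.
  rewrite ltnS => le_wn Hw ltw.
  have [p [c [q [Dp Dw Hpq]]]] := reduced_words_product (reduced_words_winv Hb) Hw.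
  have le_bw := minb w Hw ltw.
  have wE : word_val w = word_val b * word_val (p ++ q).
    rewrite -[b]winvK Dp Dw word_val_winv !word_val_cat word_val_winv invgM.
    by rewrite -!mulgA mulKg.
  (* If [w] cancels completely against [b^-1], it is a prefix of [b], and minimality of [b] forces
     [w = b]. *)
  have [q0|q_n0] := eqVneq q [::].
    have p0 : p = [::].
      apply: size0nil; apply/eqP; rewrite -leqn0 -(leq_add2r (size c)) -size_cat -Dp.
      by rewrite size_winv (leq_trans le_bw) // Dw q0 cats0 size_winv.
    by rewrite wE p0 q0 word_val_nil mulg1.
  have ltq : last x q != x.
    by move: ltw; rewrite Dw last_cat; case: (q) q_n0.
  (* Here [b] is a prefix of [w], and the rest [q] is a shorter word of [L_H] with the same last
     letter. *)
  have [p0|p_n0] := eqVneq p [::].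
    rewrite p0 /= in Hpq wE.
    rewrite wE; apply: (subgroupM sgK) => //; apply: IHn => //.
    apply: leq_trans le_wn; rewrite Dw size_cat size_winv -[size c](@size_cat _ [::]).
    by rewrite -[[::]]p0 -Dp size_winv -[X in X < _]add0n ltn_add2r.
  (* With [p] and [q] both non-empty, [p ++ q] does not end with [x], so [p] starts with [linv x].
     But [p] is a prefix of [b^-1], so [b] would end with [x]. *)
  have := headE _ Hpq; rewrite last_cat.
  have -> : last (last x p) q = last x q by case: (q) q_n0.
  move=> /(_ ltq) hdp; case/negP: ltb; apply/eqP/(inv_inj (@linvK m)).
  by rewrite -head_winv Dp -hdp; case: (p) p_n0.
have KH w : reduced_words H w -> K (word_val w).
  move: {2}(size w).+1 (ltnSn (size w)) => n; elim: n w => // n IHn w.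
  rewrite ltnS => le_wn Hw.
  have [p [c [q [Dw Db Hpq]]]] := reduced_words_product Hw Hb.
  have wbE : word_val w * word_val b = word_val (p ++ q).
    by rewrite Dw Db !word_val_cat word_val_winv -mulgA mulVKg.
  apply: (subgroupMr sgK Kb); rewrite wbE.
  (* Either all of [b] cancels and the product is shorter than [w], or the product keeps the last
     letter of [b], which is not [x]. *)
  have [q0|q_n0] := eqVneq q [::].
    apply: IHn => //; apply: leq_trans le_wn; rewrite q0 Dw !size_cat addn0.
    by rewrite -[X in X < _]addn0 ltn_add2l -size_winv -[winv c]cats0 -q0 -Db.
  apply: KB => //; move: ltb; rewrite Db !last_cat.
  by case: (q) q_n0.
apply: ncH; exists (word_val b); apply/seteqP; split=> g Hg.
  by rewrite -(fg_wordK g); apply: KH; split; rewrite ?fg_wordP ?fg_wordK.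
by apply: (smallest_sub sgH _ Hg) => _ ->; case: Hb.
Qed.

End TurningWord.

(** * Directed paths, and the Schreier graph and its core in terms of words *)

Lemma dipath_cat V L (D : lgraph V L) v1 v2 v3 p1 p2 :
  dipath D v1 p1 v2 -> dipath D v2 p2 v3 -> dipath D v1 (p1 ++ p2) v3.
Proof.
elim: p1 v1 => [|e p1 IHp] v1 /=; first by case=> _ ->.
by case=> De oe /IHp path_p1 /path_p1.
Qed.

Lemma dipath_vertex V L (D : lgraph V L) v p v' : dipath D v p v' -> vertices D v'.
Proof. by elim: p v => [|e p IHp] v /= [] => [Dv <-|_ _ /IHp]. Qed.

Section Core.
Variables (m : nat) (H : set (free_group m)).
Hypothesis sgH : subgroup H.
Implicit Types (x y : letter m) (u v w : seq (letter m)) (g : free_group m).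

Local Notation coset := (right_coset H).
Local Notation coset_edge g x := (coset g, x, coset (g * fg_letter x)).
Local Notation state u x := (coset (word_val u * fg_letter x), x).
Local Notation moore := (moore_diagram (core_automaton H)).

Fixpoint schreier_path g w :=
  if w is x :: w' then coset_edge g x :: schreier_path (g * fg_letter x) w'
  else [::].

Lemma dipath_schreier_path g w :
  dipath (schreier_graph H) (coset g) (schreier_path g w) (coset (g * word_val w)).
Proof.
elim: w g => [|x w IHw] g /=; first by rewrite word_val_nil mulg1; split=> //; exists g.
split=> //; first by exists g, x.
by rewrite word_val_cons mulgA; apply: IHw.
Qed.

Lemma label_schreier_path g w : [seq label e | e <- schreier_path g w] = w.
Proof. by elim: w g => //= x w IHw g; rewrite IHw. Qed.

Lemma schreier_edgeE g e : schreier_edges H e -> origin e = coset g ->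
  e = coset_edge g (label e).
Proof.
case=> [h [x ->]]; rewrite /origin /label /= => eq_hg.
by rewrite eq_hg (right_cosetM _ eq_hg).
Qed.

(** A Schreier edge is determined by its origin and label, hence a path by its start and its label
    word. *)
Lemma dipath_schreierE g p V : dipath (schreier_graph H) (coset g) p V ->
  p = schreier_path g (map (@label _ _) p) /\
  V = coset (g * word_val (map (@label _ _) p)).
Proof.
elim: p g => [|e p IHp] g /=; first by rewrite word_val_nil mulg1 => -[].
case=> He oe path_p; have De := schreier_edgeE He oe.
rewrite De /terminus /= in path_p; have [Dp ->] := IHp _ path_p.
by rewrite -De -Dp word_val_cons mulgA.
Qed.

Lemma mem_schreier_path g w e : e \in schreier_path g w ->
  exists u x v, w = u ++ x :: v /\ e = coset_edge (g * word_val u) x.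
Proof.
elim: w g => //= x w IHw g; rewrite inE => /predU1P[->|].
  by exists [::], x, w; rewrite word_val_nil mulg1.
case/IHw=> [u [y [v [-> ->]]]]; exists (x :: u), y, v.
by rewrite word_val_cons mulgA.
Qed.

Lemma schreier_path_cat g u v :
  schreier_path g (u ++ v) = schreier_path g u ++ schreier_path (g * word_val u) v.
Proof.
elim: u g => [|x u IHu] g /=; first by rewrite word_val_nil mulg1.
by rewrite IHu word_val_cons mulgA.
Qed.

(** Reduced closed paths at the root correspond to words of [L_H], so a core edge is a letter marked
    in such a word. This replaces graph arguments by arguments on words. *)
Lemma core_edgesP e : core_edges H e <-> exists u x v,
  reduced_words H (u ++ x :: v) /\ e = coset_edge (word_val u) x.
Proof.
split=> [[p [path_p red_p] pe]|[u [x [v [[red_w Hw] ->]]]]].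
  have /dipath_schreierE : dipath (schreier_graph H) (coset 1) p H.
    by rewrite right_coset1.
  rewrite mul1g => -[Dp /esym/(right_coset_eq1 sgH) Hp].
  move: pe; rewrite Dp => /mem_schreier_path[u [x [v []]]].
  by rewrite mul1g => Dw ->; exists u, x, v; rewrite -Dw.
exists (schreier_path 1 (u ++ x :: v)).
  split; last by rewrite label_schreier_path.
  have := dipath_schreier_path 1 (u ++ x :: v).
  by rewrite right_coset1 mul1g (right_coset_eq1 sgH _).2.
by rewrite schreier_path_cat mul1g mem_cat inE eqxx orbT.
Qed.

Lemma core_statesP q : core_states H q <-> exists u x v,
  reduced_words H (u ++ x :: v) /\ q = state u x.
Proof.
case: q => V y; split=> [[_ /= [e []]]|[u [x [v [Hw [-> ->]]]]]].
  move=> /core_edgesP[u [x [v [Hw ->]]]].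
  by rewrite /label /terminus /= => <- <-; exists u, x, v.
have coreE : core_edges H (coset_edge (word_val u) x).
  by apply/core_edgesP; exists u, x, v.
split; last by exists (coset_edge (word_val u) x).
by right; exists (coset_edge (word_val u) x); auto.
Qed.

(** * Paths in the Moore diagram and the words they spell *)

Definition moore_connected q q' := exists p, dipath moore q p q'.

Lemma moore_connected_trans q1 q2 q3 :
  moore_connected q1 q2 -> moore_connected q2 q3 -> moore_connected q1 q3.
Proof.
move=> [p1 path1] [p2 path2].
by exists (p1 ++ p2); apply: dipath_cat path1 path2.
Qed.

(** The word [u ++ v ++ w] only serves to place the edges of [v] in the core. The letter [x] need
    not be the last one of [u], so a path arriving at the root along one word can leave along
    another. *)
Lemma moore_connected_word u v w x :
  core_states H (coset (word_val u), x) -> path (fun x y => y != linv x) x v ->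
  reduced_words H (u ++ v ++ w) ->
  moore_connected (coset (word_val u), x) (coset (word_val (u ++ v)), last x v).
Proof.
elim: v u x => [|y v IHv] u x Hq /=; first by rewrite cats0; exists [::].
case/andP=> neq_yx path_v Hw.
have coreE : core_edges H (coset_edge (word_val u) y).
  by apply/core_edgesP; exists u, y, (v ++ w).
have Hq' : core_states H (state u y).
  by apply/core_statesP; exists u, y, (v ++ w).
have Eu : word_val (rcons u y) = word_val u * fg_letter y.
  by rewrite -cats1 word_val_cat word_val1.
have step : moore_connected (coset (word_val u), x) (state u y).
  exists [:: (coset (word_val u), x, y, state u y)] => /=; split=> //; split=> //.
  split; first exact/eqP.
  by exists (coset_edge (word_val u) y).
apply: moore_connected_trans step _; rewrite -Eu -cat_rcons.
by apply: IHv; rewrite ?Eu ?cat_rcons.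
Qed.

(** Conversely, a word is read off a path. The size tells when this word is empty, and the last
    clause retains that the first step uses a core edge. *)
Lemma dipath_moore_word g x p q' : dipath moore (coset g, x) p q' ->
  exists u, [/\ size u = size p, path (fun x y => y != linv x) x u,
                q' = (coset (g * word_val u), last x u) &
                forall y v, u = y :: v -> core_edges H (coset_edge g y)].
Proof.
elim: p g x => [|e p IHp] g x /=.
  by case=> _ <-; exists [::]; rewrite word_val_nil mulg1.
case: e => [[q y] q''] [[_ _ /= [neq_yx [e [He oe le Dq'']]]]] Dq.
rewrite /origin /terminus /= in Dq neq_yx oe Dq'' *; rewrite {}Dq /= in neq_yx oe.
have De : e = coset_edge g y.
  rewrite -[y]le; apply: schreier_edgeE => //.
  by case/core_edgesP: He => u [z [v [_ ->]]]; exists (word_val u), z.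
rewrite De in He Dq''.
rewrite {}Dq'' => /IHp[u [size_u path_u -> _]]; exists (y :: u); split=> /=.
- by rewrite size_u.
- by rewrite path_u andbT; apply/eqP.
- by rewrite word_val_cons mulgA.
- by move=> z v [<- _].
Qed.

(** * Ergodicity forces [H] to be conjugacy reduced and non-cyclic *)

Lemma nontrivial_reduced_word :
  nontrivial H -> exists y w, reduced_words H (y :: w).
Proof.
move=> ntH; apply: contrapT => noW; apply: ntH; apply/seteqP.
split=> [g Hg|_ ->]; last exact: subgroup1.
move: Hg; rewrite -[g]fg_wordK.
case: (fg_word g) (fg_wordP g) => [|y w] red_w Hw; first by rewrite word_val_nil.
by case: noW; exists y, w.
Qed.

Lemma state_last y w : reduced_words H (y :: w) ->
  core_states H (H, last y w).
Proof.
move=> Hw; apply/core_statesP; exists (belast y w), (last y w), [::].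
rewrite cats1 -lastI; split=> //; congr pair.
rewrite -word_val1 -word_val_cat cats1 -lastI.
by apply/esym/(right_coset_eq1 sgH); case: Hw.
Qed.

(** If all non-empty words of [L_H] had the form [a^-1 u a], every core edge leaving the root would
    be labelled [a^-1], so the state [(v_0, a)] would have no outgoing transition although another
    state exists. *)
Lemma ergodic_conjugacy_reduced :
  nontrivial H -> ergodic (core_automaton H) -> conjugacy_reduced H.
Proof.
move=> /nontrivial_reduced_word[z [w Hw]] ergH [a aH].
have [//|u Dw] := aH _ Hw; rewrite {}Dw in Hw.
have Hq1 : core_states H (coset 1, a).
  by have := state_last Hw; rewrite last_rcons right_coset1.
have Hq2 : core_states H (state [::] (linv a)).
  by apply/core_statesP; exists [::], (linv a), (rcons u a).
have [p /dipath_moore_word[v [_ path_v [_ Dlast] core_v]]] := ergH _ _ Hq1 Hq2.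
case: v => [|y v] in path_v Dlast core_v.
  by have := linv_neq a; rewrite Dlast eqxx.
have /core_edgesP[u1 [x [v1 [[red_w1 Hw1] [Du1 Dy _]]]]] := core_v _ _ erefl.
rewrite -{}Dy in red_w1 Hw1; case/andP: path_v => /eqP neq_ya _; apply: neq_ya.
(* The edge labelled [y] starts at the root, so the prefix before it lies in [H] and the suffix
   [y :: v1] is itself a word of [L_H]. *)
have Hu1 : H (word_val u1).
  by apply/(right_coset_eq1 sgH); rewrite -Du1 right_coset1.
have Hyv1 : reduced_words H (y :: v1).
  split; first exact: reduced_catr red_w1.
  by apply: (subgroupMl sgH Hu1); rewrite -word_val_cat.
by have [//|u2 [->]] := aH _ Hyv1.
Qed.

(* If [w = y ... x] is in [L_H], a path from [(v_0, x)] to [(v_0, y^-1)] spells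
   a word [u] such that [w u] is reduced whereas [u w] is not. *)
Lemma ergodic_not_cyclic :
  nontrivial H -> ergodic (core_automaton H) -> ~ cyclic H.
Proof.
move=> /nontrivial_reduced_word[y [w Hw]] ergH cycH.
have Hq1 : core_states H (coset 1, last y w).
  by rewrite right_coset1; apply: state_last.
have Hq2 : core_states H (state [::] y).
  by apply/core_statesP; exists [::], y, w.
have Hq3 : core_states H (H, linv y).
  have := reduced_words_winv sgH Hw; rewrite /winv map_cons rev_cons.
  case: (rev _) => [|z v] /=; first exact: state_last.
  by move/state_last; rewrite last_rcons.
(* The detour through a state with letter [y] makes the spelled word non-empty even when the first
   and last states coincide. *)
have [p1 path1] := ergH _ _ Hq1 Hq2; have [p2 path2] := ergH _ _ Hq2 Hq3.
have /dipath_moore_word[u [size_u path_u [Du Dlast] _]] := dipath_cat path1 path2.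
have {Du} Hu : H (word_val u).
  by apply/(right_coset_eq1 sgH); rewrite -[word_val u]mul1g -Du.
case/lastP: u => [|u z] in size_u path_u Dlast Hu.
  move: size_u path2; rewrite size_cat; case: p2 => [_ [_ [_ /esym/eqP]]|e p2].
    by rewrite (negPf (linv_neq y)).
  by rewrite addnS.
rewrite last_rcons in Dlast; rewrite -{}Dlast in path_u Hu.
case: Hw => red_w Hw.
have red_wu : reduced ((y :: w) ++ rcons u (linv y)).
  by rewrite /reduced /= cat_path path_u andbT.
(* Commuting the two factors makes [linv y] meet [y], so the value of a reduced word is also that of
   a word two letters shorter. *)
have := size_word_val (u ++ w).
have -> : word_val (u ++ w) = word_val ((y :: w) ++ rcons u (linv y)).
  rewrite [RHS]word_val_cat (cyclic_commute cycH Hw Hu) -cats1 !word_val_cat.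
  by rewrite word_val1 word_val_cons fg_letter_linv -!mulgA mulKg.
rewrite reduced_word_valK // !size_cat /= size_rcons addSn addnS addnC.
by rewrite ltnNge leqnSn.
Qed.

(** * Conjugacy reduced and non-cyclic subgroups give ergodic automata *)

Lemma conjugacy_reduced_ergodic :
  conjugacy_reduced H -> ~ cyclic H -> ergodic (core_automaton H).
Proof.
move=> crH ncH q q' /= Hq Hq'.
have [u [x [v [Hw Dq]]]] := (core_statesP q).1 Hq.
have [u' [y [v' [Hw' Dq']]]] := (core_statesP q').1 Hq'.
have rootE w : reduced_words H w -> coset (word_val w) = H.
  by case=> _ Hw1; apply/(right_coset_eq1 sgH).
set z := last x v.
have uxE : word_val u * fg_letter x = word_val (rcons u x).
  by rewrite -cats1 word_val_cat word_val1.
(* Reading the rest [v] of the word leads to the root. If [v] is empty, [q] is already there and the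
   default gives [z = x]. *)
have to_root : moore_connected q (H, z).
  have := @moore_connected_word (rcons u x) v [::] x.
  rewrite -uxE -Dq cats0 cat_rcons (rootE _ Hw).
  by apply=> //; case: Hw => /reduced_catr.
have Hz : core_states H (H, z).
  by have [p path_p] := to_root; apply: dipath_vertex path_p.
apply: moore_connected_trans to_root _.
have path_root t w y0 : reduced w -> w <> [::] -> head y0 w != linv t ->
    path (fun x y => y != linv x) t w.
  by case: w => //= s w red_w _ ->.
have word_root t w w' : core_states H (H, t) -> path (fun x y => y != linv x) t w ->
    reduced_words H (w ++ w') -> moore_connected (H, t) (coset (word_val w), last t w).
  have := @moore_connected_word [::] w w' t.
  by rewrite word_val_nil right_coset1.
(* [head y u'] is the first letter of [rcons u' y], also when [u'] is empty. *)
have from_root t : core_states H (H, t) -> head y u' != linv t ->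
    moore_connected (H, t) q'.
  move=> Ht neq_t; have := word_root t (rcons u' y) v' Ht.
  rewrite last_rcons cat_rcons Dq' -cats1 word_val_cat word_val1 cats1; apply=> //.
  apply: (path_root _ _ y); last by rewrite headI.
    by case: Hw'; rewrite -cat_rcons => /reduced_catl.
  by case: (u').
(* If the word towards [q'] starts with the forbidden letter [linv z], a turning word is read first:
   it may follow [z], and its last letter differs from [z], so [linv z] may follow it. *)
have [Dy|] := eqVneq (head y u') (linv z); last exact: from_root.
have [w [Hw1 hdw ltw]] := turning_word sgH z crH ncH.
have w_n0 : w <> [::] by move=> w0; rewrite w0 eqxx in ltw.
have to_w : moore_connected (H, z) (H, last z w).
  rewrite -{2}(rootE _ Hw1); apply: (word_root _ _ [::]); rewrite ?cats0 //.
  by apply: path_root hdw; case: Hw1.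
apply: moore_connected_trans to_w _; apply: from_root.
  by case: (w) w_n0 Hw1 => //= s w' _; apply: state_last.
by rewrite Dy (inj_eq (inv_inj (@linvK m))) eq_sym.
Qed.

End Core.

Theorem theorem5p14 (m : nat) (H : set (free_group m)) :
  subgroup H -> nontrivial H -> finitely_generated H ->
  ergodic (core_automaton H) <-> (conjugacy_reduced H /\ ~ cyclic H).
Proof.
move=> sgH ntH _; split=> [ergH|[crH ncH]].
  by split; [apply: ergodic_conjugacy_reduced | apply: ergodic_not_cyclic].
exact: conjugacy_reduced_ergodic.
Qed.
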